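(* The map $$\mathcal S: L^2([0,1])\times\big(Z\cap\mathscr S(\mathbb R)\big)\to Y,\qquad (f,\phi)\mapsto \sum_{k\in\mathbb Z}\hat f(k)\,\big(\mathcal S_\phi e^{2\pi i k\cdot}\big)(b,\xi),$$ where $f=\sum_{k}\hat f(k)e^{2\pi i k t}$ and $(\mathcal S_\phi e^{2\pi i k\cdot})(b,\xi)=e^{2\pi i b(k-\xi)}\,\overline{\hat\phi\big(\tfrac{k-\xi}{\xi}\big)}$ for $b\in\mathbb R$, $\xi\neq 0$, is well defined and continuous (with respect to the $L^2([0,1])$ norm, the norm $\|\cdot\|_Z$ and the norm $\|\cdot\|_Y$).
   Context: The Fourier transform on $\mathbb R$ is $\hat\phi(\xi)=(2\pi)^{-1/2}\int_{\mathbb R}e^{-2\pi i t\xi}\phi(t)\,dt$ (extended to tempered distributions), and for $f\in L^2([0,1])$ (1-periodic), $\hat f(k)=\int_0^1 f(t)e^{-2\pi i k t}dt$. $Z$ is the Hilbert space of admissible windows: $Z=\{\phi\in\mathscr S'(\mathbb R): \int_{\mathbb R}|\hat\phi(\xi)|^2\frac{d\xi}{|1+\xi|}<\infty\}$ with inner product $(\phi,\phi')_Z=\int\hat\phi(\xi)\overline{\hat{\phi'}(\xi)}\frac{d\xi}{|1+\xi|}$. $Y$ is the Hilbert space of functions $g(b,\xi)=\sum_{k\in\mathbb Z}c_k(\xi)e^{2\pi i(k-\xi)b}$ with $c_k\in L^2(\mathbb R,\frac{d\xi}{|\xi|})$ and $\sum_k\|c_k\|^2_{L^2(\mathbb R,d\xi/|\xi|)}<\infty$,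 with inner product $(g,g')_Y=\int_0^1\int_{\mathbb R}g(b,\xi)\overline{g'(b,\xi)}\frac{d\xi}{|\xi|}\,db$ and norm $\|g\|_Y=(\sum_k\|c_k\|^2_{L^2(\mathbb R,d\xi/|\xi|)})^{1/2}$. *)

(* Defs.v *)
From HB Require Import structures.
From mathcomp Require Import all_boot all_order all_algebra.
From mathcomp Require Import all_classical all_reals all_analysis.
From mathcomp Require Import complex.
Import Order.TTheory GRing.Theory Num.Theory.

Set Implicit Arguments.
Unset Strict Implicit.
Unset Printing Implicit Defensive.

Local Open Scope ring_scope.
Local Open Scope complex_scope.
Local Open Scope classical_set_scope.

Section Defs.
Variable R : realType.

Local Notation mu := (@lebesgue_measure R).

Definition cnorm2 (z : R[i]) : R := complex.Re z ^+ 2 + complex.Im z ^+ 2.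

Definition expi (theta : R) : R[i] := cos theta +i* sin theta.

Definition cintegral (D : set R) (g : R -> R[i]) : R[i] :=
  (Rintegral mu D (fun x => complex.Re (g x)))%:C
  + 'i * (Rintegral mu D (fun x => complex.Im (g x)))%:C.

Definition cmeasurable (D : set R) (g : R -> R[i]) : Prop :=
  measurable_fun D (fun x => complex.Re (g x)) /\ measurable_fun D (fun x => complex.Im (g x)).

Definition L2_01 (f : R -> R[i]) : Prop :=
  cmeasurable `[0%R, 1%R] f /\
  (\int[mu]_(t in `[0%R, 1%R]) (cnorm2 (f t))%:E < +oo)%E.

Definition L2norm01 (f : R -> R[i]) : R :=
  Num.sqrt (fine (\int[mu]_(t in `[0%R, 1%R]) (cnorm2 (f t))%:E)%E).

Definition fcoef (f : R -> R[i]) (k : int) : R[i] :=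
  cintegral `[0%R, 1%R] (fun t => f t * expi (- (2 * pi * k%:~R * t))).

Definition schwartz_real (g : R -> R) : Prop :=
  (forall (n : nat) (x : R), derivable (derive1n n g) x 1) /\
  (forall m n : nat, exists C : R, forall x : R,
      `|x| ^+ m * `|derive1n n g x| <= C).

Definition schwartz (phi : R -> R[i]) : Prop :=
  schwartz_real (fun t => complex.Re (phi t)) /\ schwartz_real (fun t => complex.Im (phi t)).

Definition ft (phi : R -> R[i]) (xi : R) : R[i] :=
  ((Num.sqrt (2 * pi))^-1)%:C *
  cintegral [set: R] (fun t => expi (- (2 * pi * t * xi)) * phi t).

Definition Znorm2 (phi : R -> R[i]) : \bar R :=
  (\int[mu]_(xi in [set: R]) (cnorm2 (ft phi xi) / `|1 + xi|)%:E)%E.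

Definition inZ (phi : R -> R[i]) : Prop :=
  cmeasurable [set: R] (ft phi) /\ (Znorm2 phi < +oo)%E.

Definition Znorm (phi : R -> R[i]) : R := Num.sqrt (fine (Znorm2 phi)).

(* ---------- the space Y ----------
   An element g(b,xi) = sum_k c_k(xi) e^{2 pi i (k - xi) b} of Y is represented
   by its coefficient family c : int -> R -> C. *)
Definition Ycoef_norm2 (c : R -> R[i]) : \bar R :=
  (\int[mu]_(xi in [set: R]) (cnorm2 (c xi) / `|xi|)%:E)%E.

Definition Ynorm2 (c : int -> R -> R[i]) : \bar R :=
  (\esum_(k in [set: int]) Ycoef_norm2 (c k))%E.

Definition inY (c : int -> R -> R[i]) : Prop :=
  (forall k : int, cmeasurable [set: R] (c k) /\ (Ycoef_norm2 (c k) < +oo)%E)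
  /\ (Ynorm2 c < +oo)%E.

Definition Ynorm (c : int -> R -> R[i]) : R := Num.sqrt (fine (Ynorm2 c)).

Definition Yfun (c : int -> R -> R[i]) (k : int) (b xi : R) : R[i] :=
  c k xi * expi (2 * pi * b * (k%:~R - xi)).

(* ---------- the map S ----------
   S(f,phi)(b,xi) = sum_k \hat f(k) e^{2 pi i b (k - xi)} conj(\hat phi((k-xi)/xi)),
   whose k-th coefficient is  \hat f(k) conj(\hat phi((k-xi)/xi)). *)
Definition Scoef (f phi : R -> R[i]) (k : int) (xi : R) : R[i] :=
  fcoef f k * (ft phi ((k%:~R - xi) / xi))^*.

End Defs.

(* Main.v *)
(** For [k <> 0] the substitution [eta = k / xi - 1] turns [dxi / |xi|] into
    [deta / |1 + eta|], so the [k]-th coefficient of [S(f, phi)] has squared norm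
    [|f^(k)|^2 ||phi||_Z^2]. For [k = 0] it is the constant [phi^(-1)], which
    vanishes: [phi^] is continuous and [|phi^|^2 / |1 + xi|] is integrable near
    the pole [-1]. Bessel's inequality then gives
    [||S(f, phi)||_Y <= ||f|| ||phi||_Z], and continuity follows by bilinearity
    from [S(f, phi) - S(f', phi') = S(f - f', phi) + S(f', phi - phi')]. *)

Require Import Defs.
From HB Require Import structures.
From mathcomp Require Import all_boot all_order all_algebra.
From mathcomp Require Import all_classical all_reals all_analysis.
From mathcomp Require Import measurable_realfun complex.
From mathcomp Require Import ring lra.
Import Order.TTheory GRing.Theory Num.Theory.
Import numFieldNormedType.Exports.
Local Open Scope ring_scope.
Local Open Scope complex_scope.
Local Open Scope classical_set_scope.

(** * Complex-valued integrals *)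

Section ComplexIntegral.
Variable R : realType.
Local Notation mu := (@lebesgue_measure R).
Local Notation I01 := (`[0%R, 1%R]%classic : set R).
Implicit Types (f g : R -> R[i]) (D : set R).

Lemma ReD (z w : R[i]) : complex.Re (z + w) = complex.Re z + complex.Re w.
Proof. by case: z w => [a b] [c d]. Qed.

Lemma ImD (z w : R[i]) : complex.Im (z + w) = complex.Im z + complex.Im w.
Proof. by case: z w => [a b] [c d]. Qed.

Lemma ReN (z : R[i]) : complex.Re (- z) = - complex.Re z.
Proof. by case: z. Qed.

Lemma ImN (z : R[i]) : complex.Im (- z) = - complex.Im z.
Proof. by case: z. Qed.

Lemma ReM (z w : R[i]) : complex.Re (z * w) =
  complex.Re z * complex.Re w - complex.Im z * complex.Im w.
Proof. by case: z w => [a b] [c d]. Qed.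

Lemma ImM (z w : R[i]) : complex.Im (z * w) =
  complex.Re z * complex.Im w + complex.Im z * complex.Re w.
Proof. by case: z w => [a b] [c d]. Qed.

Lemma ReJ (z : R[i]) : complex.Re (z^*) = complex.Re z.
Proof. by case: z. Qed.

Lemma ImJ (z : R[i]) : complex.Im (z^*) = - complex.Im z.
Proof. by case: z. Qed.

Lemma complex_ReIm (z w : R[i]) :
  complex.Re z = complex.Re w -> complex.Im z = complex.Im w -> z = w.
Proof. by case: z w => [a b] [c d] /= -> ->. Qed.

Lemma cnorm2_ge0 (z : R[i]) : 0 <= cnorm2 z.
Proof. by rewrite /cnorm2 addr_ge0 ?sqr_ge0. Qed.

Lemma cnorm2M (z w : R[i]) : cnorm2 (z * w) = cnorm2 z * cnorm2 w.
Proof. rewrite /cnorm2 ReM ImM; ring. Qed.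

Lemma cnorm2J (z : R[i]) : cnorm2 (z^*) = cnorm2 z.
Proof. by rewrite /cnorm2 ReJ ImJ sqrrN. Qed.

Lemma cnorm2_expi (t : R) : cnorm2 (expi t) = 1.
Proof. by rewrite /cnorm2 /= cos2Dsin2. Qed.

Lemma cnorm2D_le (z w : R[i]) : cnorm2 (z + w) <= 2 * cnorm2 z + 2 * cnorm2 w.
Proof.
rewrite /cnorm2 ReD ImD.
have := sqr_ge0 (complex.Re z - complex.Re w).
have := sqr_ge0 (complex.Im z - complex.Im w).
nra.
Qed.

Lemma cnorm2N (z : R[i]) : cnorm2 (- z) = cnorm2 z.
Proof. by rewrite /cnorm2 ReN ImN !sqrrN. Qed.

Lemma expiD (s t : R) : expi (s + t) = expi s * expi t.
Proof.
apply: complex_ReIm; first by rewrite ReM /= cosD.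
by rewrite ImM /= sinD addrC mulrC [X in _ + X]mulrC addrC; ring.
Qed.

Lemma ler_norm_1Dsqr (a : R) : `|a| <= 1 + a ^+ 2.
Proof. by rewrite ler_norml; apply/andP; split; nra. Qed.

Definition cintegrable D f :=
  mu.-integrable D (EFin \o (fun x => complex.Re (f x))) /\
  mu.-integrable D (EFin \o (fun x => complex.Im (f x))).

Lemma Re_cintegral D f :
  complex.Re (cintegral D f) = (\int[mu]_(x in D) complex.Re (f x))%R.
Proof. by rewrite /cintegral ReD ReM /=; ring. Qed.

Lemma Im_cintegral D f :
  complex.Im (cintegral D f) = (\int[mu]_(x in D) complex.Im (f x))%R.
Proof. by rewrite /cintegral ImD ImM /=; ring. Qed.

Lemma integrable_lincomb D (a b : R) (u v : R -> R) : measurable D ->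
  mu.-integrable D (EFin \o u) -> mu.-integrable D (EFin \o v) ->
  mu.-integrable D (EFin \o (fun x => a * u x + b * v x)).
Proof.
move=> mD iu iv.
have -> : EFin \o (fun x => a * u x + b * v x) =
  (fun x => a%:E * (EFin \o u) x)%E \+ (fun x => b%:E * (EFin \o v) x)%E.
  by apply/funext => x /=; rewrite EFinD !EFinM.
by apply: integrableD => //; apply: integrableZl.
Qed.

Lemma Rintegral_lincomb D (a b : R) (u v : R -> R) : measurable D ->
  mu.-integrable D (EFin \o u) -> mu.-integrable D (EFin \o v) ->
  (\int[mu]_(x in D) (a * u x + b * v x) =
   a * \int[mu]_(x in D) u x + b * \int[mu]_(x in D) v x)%R.
Proof.
move=> mD iu iv.
have iZ c w : mu.-integrable D (EFin \o w) ->
    mu.-integrable D (EFin \o (fun x => c * w x)).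
  move=> iw; have -> : EFin \o (fun x => c * w x) =
    (fun x => c%:E * (EFin \o w) x)%E by apply/funext => x /=; rewrite EFinM.
  exact: integrableZl.
by rewrite RintegralD ?RintegralZl//; apply: iZ.
Qed.

Lemma cintegrableD D f g : measurable D ->
  cintegrable D f -> cintegrable D g -> cintegrable D (fun x => f x + g x).
Proof.
move=> mD [f1 f2] [g1 g2]; split.
- have -> : (fun x => complex.Re (f x + g x)) =
      (fun x => 1 * complex.Re (f x) + 1 * complex.Re (g x)).
    by apply/funext => x; rewrite ReD !mul1r.
  exact: integrable_lincomb.
- have -> : (fun x => complex.Im (f x + g x)) =
      (fun x => 1 * complex.Im (f x) + 1 * complex.Im (g x)).
    by apply/funext => x; rewrite ImD !mul1r.
  exact: integrable_lincomb.
Qed.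

Lemma cintegrableZ D (c : R[i]) f : measurable D ->
  cintegrable D f -> cintegrable D (fun x => c * f x).
Proof.
move=> mD [f1 f2]; split.
- have -> : (fun x => complex.Re (c * f x)) = (fun x =>
      complex.Re c * complex.Re (f x) + (- complex.Im c) * complex.Im (f x)).
    by apply/funext => x; rewrite ReM mulNr.
  exact: integrable_lincomb.
- have -> : (fun x => complex.Im (c * f x)) = (fun x =>
      complex.Re c * complex.Im (f x) + complex.Im c * complex.Re (f x)).
    by apply/funext => x; rewrite ImM.
  exact: integrable_lincomb.
Qed.

Lemma cintegralD D f g : measurable D -> cintegrable D f -> cintegrable D g ->
  cintegral D (fun x => f x + g x) = cintegral D f + cintegral D g.
Proof.
move=> mD [f1 f2] [g1 g2]; apply: complex_ReIm.
- rewrite Re_cintegral ReD !Re_cintegral -RintegralD//.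
  by apply: eq_Rintegral => x _; rewrite ReD.
- rewrite Im_cintegral ImD !Im_cintegral -RintegralD//.
  by apply: eq_Rintegral => x _; rewrite ImD.
Qed.

Lemma cintegralZ D (c : R[i]) f : measurable D -> cintegrable D f ->
  cintegral D (fun x => c * f x) = c * cintegral D f.
Proof.
move=> mD [f1 f2]; apply: complex_ReIm.
- rewrite Re_cintegral ReM Re_cintegral Im_cintegral -mulNr -Rintegral_lincomb//.
  by apply: eq_Rintegral => x _; rewrite ReM mulNr.
- rewrite Im_cintegral ImM Im_cintegral Re_cintegral -Rintegral_lincomb//.
  by apply: eq_Rintegral => x _; rewrite ImM.
Qed.

Lemma continuous_expi_linear (a : R) :
  continuous (fun t : R => cos (a * t)) /\ continuous (fun t : R => sin (a * t)).
Proof.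
split=> t; apply: (@continuous_comp _ _ _ ( *%R a)).
- exact: mulrl_continuous.
- exact: continuous_cos.
- exact: mulrl_continuous.
- exact: continuous_sin.
Qed.

Lemma cintegrable_mul_expi D f (a : R) : measurable D ->
  cintegrable D f -> cintegrable D (fun t => f t * expi (a * t)).
Proof.
move=> mD [f1 f2].
have [cc cs] := continuous_expi_linear a.
have mc : measurable_fun D (fun t : R => cos (a * t)).
  by apply: measurable_funTS; exact: continuous_measurable_fun.
have ms : measurable_fun D (fun t : R => sin (a * t)).
  by apply: measurable_funTS; exact: continuous_measurable_fun.
have mulc (u : R -> R) : mu.-integrable D (EFin \o u) ->
    mu.-integrable D (EFin \o (fun t => u t * cos (a * t))) /\
    mu.-integrable D (EFin \o (fun t => u t * sin (a * t))).
  move=> iu; have mu_ := measurable_int _ iu.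
  have {}mu_ : measurable_fun D u by apply/measurable_EFinP.
  split.
    apply: le_integrable iu => //.
      by apply/measurable_EFinP; exact: measurable_funM.
    move=> x _ /=; rewrite lee_fin normrM ler_piMr//.
    by rewrite ler_norml cos_geN1 cos_le1.
  apply: le_integrable iu => //.
    by apply/measurable_EFinP; exact: measurable_funM.
  move=> x _ /=; rewrite lee_fin normrM ler_piMr//.
  by rewrite ler_norml sin_geN1 sin_le1.
have [f1c f1s] := mulc _ f1; have [f2c f2s] := mulc _ f2; split.
- have -> : (fun t => complex.Re (f t * expi (a * t))) = (fun t =>
      1 * (complex.Re (f t) * cos (a * t)) +
      (-1) * (complex.Im (f t) * sin (a * t))).
    by apply/funext => x; rewrite ReM /= mul1r mulN1r.
  exact: integrable_lincomb.
- have -> : (fun t => complex.Im (f t * expi (a * t))) = (fun t =>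
      1 * (complex.Re (f t) * sin (a * t)) +
      1 * (complex.Im (f t) * cos (a * t))).
    by apply/funext => x; rewrite ImM /= !mul1r.
  exact: integrable_lincomb.
Qed.

Lemma measurable_cnorm2 D f : cmeasurable D f ->
  measurable_fun D (fun x => cnorm2 (f x)).
Proof. by move=> [m1 m2]; apply: measurable_funD; apply: measurable_funX. Qed.

Lemma cmeasurableD D f g : cmeasurable D f -> cmeasurable D g ->
  cmeasurable D (fun x => f x + g x).
Proof.
move=> [f1 f2] [g1 g2]; split.
- under eq_fun do rewrite ReD; exact: measurable_funD.
- under eq_fun do rewrite ImD; exact: measurable_funD.
Qed.

Lemma cmeasurableM D f g : cmeasurable D f -> cmeasurable D g ->
  cmeasurable D (fun x => f x * g x).
Proof.
move=> [f1 f2] [g1 g2]; split.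
- under eq_fun do rewrite ReM.
  by apply: measurable_funB; exact: measurable_funM.
- under eq_fun do rewrite ImM.
  by apply: measurable_funD; exact: measurable_funM.
Qed.

Lemma cmeasurable_cst D (c : R[i]) : cmeasurable D (fun=> c).
Proof. by split; exact: measurable_cst. Qed.

End ComplexIntegral.

(** * Bessel's inequality *)

Section Bessel.
Variable R : realType.
Local Notation mu := (@lebesgue_measure R).
Local Notation I01 := (`[0%R, 1%R]%classic : set R).
Implicit Types f g : R -> R[i].

Let mI01 : measurable I01. Proof. exact: measurable_itv. Qed.

Lemma cos_sin_2pin (n : nat) :
  cos (2 * pi * n%:R : R) = 1 /\ sin (2 * pi * n%:R : R) = 0.
Proof.
elim: n => [|n [IHc IHs]]; first by rewrite mulr0 cos0 sin0.
have -> : 2 * pi * n.+1%:R = 2 * pi * n%:R + pi *+ 2 :> R.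
  by rewrite -natr1 mulr2n; ring.
by rewrite cosD cos2pi sin2pi sinD cos2pi sin2pi IHc IHs; split; ring.
Qed.

Lemma cos_sin_2piz (k : int) :
  cos (2 * pi * k%:~R : R) = 1 /\ sin (2 * pi * k%:~R : R) = 0.
Proof.
case: k => n; first exact: cos_sin_2pin.
have [hc hs] := cos_sin_2pin n.+1.
rewrite NegzE mulrNz mulrN cosN sinN; split; first exact: hc.
by rewrite [sin _]hs oppr0.
Qed.

Lemma cintegral_expi (k : int) : k != 0 ->
  cintegral I01 (fun t => expi (2 * pi * k%:~R * t)) = 0 :> R[i].
Proof.
move=> k0; set a : R := 2 * pi * k%:~R.
have a0 : a != 0.
  by rewrite /a !mulf_neq0 ?pnatr_eq0 ?intr_eq0// gt_eqF ?pi_gt0.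
have [hc hs] := cos_sin_2piz k; rewrite -/a in hc hs.
have [cc cs] := continuous_expi_linear R a.
have FTC (u F : R -> R) : continuous u ->
    (forall x : R, is_derive x (1 : R) F (u x)) ->
    (\int[mu]_(x in I01) u x = F 1 - F 0)%R.
  move=> cu dF; have cF : continuous F.
    move=> x; apply: differentiable_continuous; apply/derivable1_diffP.
    by have [] := dF x.
  rewrite /Rintegral (@continuous_FTC2 _ _ F)//.
  - exact: continuous_subspaceT.
  - split.
    + by move=> x _; have [] := dF x.
    + by apply: cvg_at_right_filter; exact: cF.
    + by apply: cvg_at_left_filter; exact: cF.
  - by move=> x _; rewrite derive1E; have [] := dF x.
have dM (x : R) : is_derive x (1 : R) ( *%R a) a.
  have -> : a = a *: (1 : R) :> R by rewrite /GRing.scale/= mulr1.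
  rewrite [X in is_derive _ _ X _](_ : _ = a \*: (@id R)).
    exact: is_deriveZ.
  by apply/funext => y; rewrite /GRing.scale/= mulr1.
have dS (x : R) : is_derive x (1 : R) (a^-1 \*: (sin \o ( *%R a))) (cos (a * x)).
  apply: (is_derive_eq (is_deriveZ _ (is_derive1_comp (is_derive_sin _) (dM x)))).
  by rewrite /GRing.scale/= mulrC mulfK.
have dC (x : R) :
    is_derive x (1 : R) (- a^-1 \*: (cos \o ( *%R a))) (sin (a * x)).
  apply: (is_derive_eq (is_deriveZ _ (is_derive1_comp (is_derive_cos _) (dM x)))).
  by rewrite /GRing.scale/= !mulNr mulrN opprK mulrC mulfK.
apply: complex_ReIm.
- rewrite Re_cintegral /= (FTC _ _ cc dS) /GRing.scale/=.
  by rewrite mulr1 mulr0 sin0 hs; ring.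
- rewrite Im_cintegral /= (FTC _ _ cs dC) /GRing.scale/=.
  by rewrite mulr1 mulr0 cos0 hc; ring.
Qed.

Lemma integrable_cst_I01 (c : R) : mu.-integrable I01 (EFin \o (fun=> c)).
Proof.
apply: continuous_compact_integrable; first exact: segment_compact.
by apply: continuous_subspaceT => x; exact: cvg_cst.
Qed.

Lemma Rintegral_cst_I01 (c : R) : (\int[mu]_(x in I01) c = c)%R.
Proof.
by rewrite Rintegral_cst//= lebesgue_measure_itv/= lte01 sube0 mulr1.
Qed.

Lemma L2_01_integrable_cnorm2 f : L2_01 f ->
  mu.-integrable I01 (EFin \o (fun t => cnorm2 (f t))).
Proof.
move=> [mf fy]; apply/integrableP; split.
  by apply/measurable_EFinP; exact: measurable_cnorm2.
under eq_integral => x _ do rewrite /= ger0_norm ?cnorm2_ge0//.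
exact: fy.
Qed.

Lemma L2_01_cintegrable f : L2_01 f -> cintegrable R I01 f.
Proof.
move=> hf; have i2 := L2_01_integrable_cnorm2 f hf.
have i1 : mu.-integrable I01
    (EFin \o (fun t => 1 * 1 + 1 * cnorm2 (f t))).
  by apply: integrable_lincomb => //; exact: integrable_cst_I01.
have [[m1 m2] _] := hf.
split; apply: le_integrable i1 => //.
- exact/measurable_EFinP.
- move=> x _ /=; rewrite lee_fin !mul1r (le_trans (ler_norm_1Dsqr _ _))//.
  by rewrite ler_normr lerD2l lerDl sqr_ge0.
- exact/measurable_EFinP.
- move=> x _ /=; rewrite lee_fin !mul1r (le_trans (ler_norm_1Dsqr _ _))//.
  by rewrite ler_normr lerD2l lerDr sqr_ge0.
Qed.

Lemma L2_01D f g : L2_01 f -> L2_01 g -> L2_01 (fun t => f t + g t).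
Proof.
move=> hf hg; have [mf _] := hf; have [mg _] := hg.
have mD := cmeasurableD _ _ _ _ mf mg.
split=> //.
have := integrable_lincomb _ _ 2 2 _ _ mI01
  (L2_01_integrable_cnorm2 f hf) (L2_01_integrable_cnorm2 g hg).
move=> i; apply: le_lt_trans (integrable_lty _ i) => //.
apply: ge0_le_integral => //.
- by move=> x _; rewrite lee_fin cnorm2_ge0.
- by apply/measurable_EFinP; exact: measurable_cnorm2.
- exact: measurable_int i.
- by move=> x _; rewrite lee_fin cnorm2D_le.
Qed.

Lemma L2_01_bounded f : cmeasurable I01 f ->
  (exists C, forall x, cnorm2 (f x) <= C) -> L2_01 f.
Proof.
move=> mf [C fC]; split=> //.
apply: le_lt_trans (integrable_lty _ (integrable_cst_I01 C)) => //.
apply: ge0_le_integral => //.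
- by move=> x _; rewrite lee_fin cnorm2_ge0.
- by apply/measurable_EFinP; exact: measurable_cnorm2.
- exact: measurable_cst.
- by move=> x _; rewrite lee_fin.
Qed.

Lemma L2_01N f : L2_01 f -> L2_01 (fun t => - f t).
Proof.
move=> [[m1 m2] fy]; split.
  have eR : (fun t => complex.Re (- f t)) = \- (fun t => complex.Re (f t)).
    by apply/funext => t; rewrite ReN.
  have eI : (fun t => complex.Im (- f t)) = \- (fun t => complex.Im (f t)).
    by apply/funext => t; rewrite ImN.
  by split; rewrite ?eR ?eI; exact: measurable_funN.
by under eq_integral do rewrite cnorm2N.
Qed.

Lemma L2_01_harmonic (c : R[i]) (a : R) : L2_01 (fun t => c * expi (a * t)).
Proof.
apply: L2_01_bounded; last first.
  by exists (cnorm2 c) => x; rewrite cnorm2M cnorm2_expi mulr1.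
apply: cmeasurableM; first exact: cmeasurable_cst.
have [cc cs] := continuous_expi_linear R a.
by split; apply: measurable_funTS; exact: continuous_measurable_fun.
Qed.

Lemma cintegrable_fcoef f (k : int) : L2_01 f ->
  cintegrable R I01 (fun t => f t * expi (- (2 * pi * k%:~R * t))).
Proof.
move=> hf.
rewrite (_ : (fun t => _) = fun t => f t * expi (- (2 * pi * k%:~R) * t)).
  by apply: cintegrable_mul_expi => //; exact: L2_01_cintegrable.
by apply/funext => t; rewrite mulNr.
Qed.

Lemma fcoefD f g k : L2_01 f -> L2_01 g ->
  fcoef (fun t => f t + g t) k = fcoef f k + fcoef g k.
Proof.
move=> hf hg; have := cintegrable_fcoef f k hf; have := cintegrable_fcoef g k hg.
move=> ig if_; rewrite /fcoef -cintegralD//.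
by congr cintegral; apply/funext => t; rewrite mulrDl.
Qed.

Lemma fcoefZ f k (c : R[i]) : L2_01 f ->
  fcoef (fun t => c * f t) k = c * fcoef f k.
Proof.
move=> hf; have if_ := cintegrable_fcoef f k hf.
rewrite /fcoef -cintegralZ//.
by congr cintegral; apply/funext => t; rewrite mulrA.
Qed.

Lemma fcoef_harmonic (c : R[i]) (j k : int) : j != k ->
  fcoef (fun t => c * expi (2 * pi * k%:~R * t)) j = 0.
Proof.
move=> jk; have e1 : L2_01 (fun t : R => expi (2 * pi * k%:~R * t)).
  have := L2_01_harmonic 1 (2 * pi * k%:~R).
  by under eq_fun do rewrite mul1r.
rewrite fcoefZ// /fcoef.
rewrite (_ : (fun t => _) = fun t => expi (2 * pi * (k - j)%:~R * t)).
  by rewrite cintegral_expi ?mulr0// subr_eq0 eq_sym.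
by apply/funext => t; rewrite -expiD intrB; congr expi; ring.
Qed.

Lemma expiN (t : R) : expi (- t) = (expi t)^* :> R[i].
Proof. by rewrite /expi cosN sinN. Qed.

Lemma cnorm2B_unit (z c e : R[i]) : cnorm2 e = 1 -> cnorm2 (z - c * e) =
  1 * (1 * cnorm2 z + (-2) * complex.Re (c^* * (z * e^*))) + 1 * cnorm2 c.
Proof.
case: z c e => [p q] [u v] [x y]; rewrite /cnorm2 /= => xy.
transitivity (p ^+ 2 + q ^+ 2 - 2 * (u * (p * x + q * y) +
  v * (q * x - p * y)) + (u ^+ 2 + v ^+ 2) * (x ^+ 2 + y ^+ 2)); first ring.
by rewrite xy; ring.
Qed.

Lemma energy_sub_harmonic f k : L2_01 f ->
  (\int[mu]_(t in I01)
     cnorm2 (f t - fcoef f k * expi (2 * pi * k%:~R * t)) =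
   \int[mu]_(t in I01) cnorm2 (f t) - cnorm2 (fcoef f k))%R.
Proof.
move=> hf; set c := fcoef f k; set a : R := 2 * pi * k%:~R.
have ie := cintegrable_mul_expi R I01 f (- a) mI01
  (L2_01_cintegrable f hf).
have [iz _] := cintegrableZ R _ (c^*) _ mI01 ie.
have ik := integrable_cst_I01 (cnorm2 c).
have i2 := L2_01_integrable_cnorm2 f hf.
transitivity (\int[mu]_(t in I01) (1 * (1 * cnorm2 (f t) +
    (-2) * complex.Re (c^* * (f t * expi (- a * t)))) + 1 * cnorm2 c))%R.
  apply: eq_Rintegral => t _.
  rewrite (mulNr a t) expiN; exact/cnorm2B_unit/cnorm2_expi.
rewrite Rintegral_lincomb//; last exact: integrable_lincomb.
rewrite Rintegral_lincomb//.
rewrite Rintegral_cst_I01.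
have -> : (\int[mu]_(t in I01) complex.Re (c^* * (f t * expi (- a * t))) =
           cnorm2 c)%R.
  rewrite -Re_cintegral cintegralZ//.
  rewrite (_ : cintegral _ _ = c).
    by rewrite ReM ReJ ImJ /cnorm2; ring.
  by rewrite /c /fcoef; congr cintegral; apply/funext => t; rewrite mulNr.
ring.
Qed.

(* Subtracting one harmonic lowers the energy by the square of its coefficient
   and leaves the other coefficients unchanged, so one peels them off in turn. *)
Lemma bessel_seq (s : seq int) f : uniq s -> L2_01 f ->
  \sum_(k <- s) cnorm2 (fcoef f k) <= (\int[mu]_(t in I01) cnorm2 (f t))%R.
Proof.
elim: s f => [|k s IH] f.
  by move=> _ _; rewrite big_nil; apply: Rintegral_ge0 => t _; exact: cnorm2_ge0.
move=> /= /andP[ks us] hf; rewrite big_cons.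
have he := L2_01N _ (L2_01_harmonic (fcoef f k) (2 * pi * k%:~R)).
have hg := L2_01D _ _ hf he.
have := IH _ us hg; rewrite energy_sub_harmonic// lerBrDl.
apply: le_trans; rewrite lerD2l big_seq [leRHS]big_seq.
apply: ler_sum => j js.
have jk : j != k by apply: contraNneq ks => <-.
rewrite fcoefD//.
rewrite (_ : fcoef (fun t => - _) j = 0) ?addr0//.
rewrite -[RHS](fcoef_harmonic (- fcoef f k) _ _ jk).
by apply: (congr1 (fun g => fcoef g j)); apply/funext => t; rewrite mulNr.
Qed.

End Bessel.

(** * The Fourier transform of a Schwartz function *)

Section FourierTransform.
Variable R : realType.
Local Notation mu := (@lebesgue_measure R).
Implicit Types phi psi : R -> R[i].

Lemma integrable_oneDsqrV :
  mu.-integrable [set: R] (EFin \o (fun x => (oneDsqr x)^-1)).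
Proof.
have cV : continuous (fun x : R => (oneDsqr x)^-1) := @continuous_oneDsqrV R.
apply/integrableP; split.
  by apply/measurable_EFinP; exact: continuous_measurable_fun.
under eq_integral => x _ do rewrite /= ger0_norm ?invr_ge0 ?oneDsqr_ge0//.
rewrite ge0_symfun_integralT//.
- by rewrite -set_itvcy integral0y_oneDsqr -EFinM ltry.
- by move=> x /=; rewrite /oneDsqr sqrrN.
Qed.

Lemma schwartz_real_integrable (g : R -> R) : schwartz_real g ->
  mu.-integrable [set: R] (EFin \o g).
Proof.
move=> [dg bg].
have cg : continuous g.
  by move=> x; apply: differentiable_continuous; apply/derivable1_diffP;
    exact: (dg 0%N).
have [C0 h0] := bg 0%N 0%N; have [C2 h2] := bg 2%N 0%N.
have i := integrableZl measurableT (C0 + C2) integrable_oneDsqrV.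
apply: le_integrable i => //.
  by apply/measurable_EFinP; exact: continuous_measurable_fun.
move=> x _ /=; rewrite lee_fin.
apply: le_trans (ler_norm _).
rewrite ler_pdivlMr ?oneDsqr_gt0// /oneDsqr mulrDr mulr1 lerD//.
  by have := h0 x; rewrite expr0 mul1r.
by have := h2 x; rewrite mulrC -normrX (ger0_norm (sqr_ge0 x)).
Qed.

Lemma schwartz_cintegrable phi : schwartz phi -> cintegrable R [set: R] phi.
Proof. by move=> [h1 h2]; split; exact: schwartz_real_integrable. Qed.

Lemma cintegrable_ft phi xi : cintegrable R [set: R] phi ->
  cintegrable R [set: R] (fun t => expi (- (2 * pi * t * xi)) * phi t).
Proof.
move=> i; rewrite (_ : (fun t => _) =
    fun t => phi t * expi (- (2 * pi * xi) * t)).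
  exact: cintegrable_mul_expi.
by apply/funext => t; rewrite mulrC; congr (_ * expi _); ring.
Qed.

Lemma ftB phi psi xi :
  cintegrable R [set: R] phi -> cintegrable R [set: R] psi ->
  ft (fun t => phi t - psi t) xi = ft phi xi - ft psi xi.
Proof.
move=> iphi ipsi.
have i1 := cintegrable_ft _ xi iphi; have i2 := cintegrable_ft _ xi ipsi.
have i3 := cintegrableZ R _ (-1) _ measurableT i2.
rewrite /ft -mulrBr; congr (_ * _).
rewrite -[X in _ = _ + X]mulN1r -cintegralZ// -cintegralD//.
by congr cintegral; apply/funext => t; rewrite mulN1r mulrBr.
Qed.

Lemma continuous_cos_sin_ft (t : R) :
  continuous (fun xi : R => cos (- (2 * pi * t * xi))) /\
  continuous (fun xi : R => sin (- (2 * pi * t * xi))).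
Proof.
have [cc cs] := continuous_expi_linear R (- (2 * pi * t)).
by split; [under eq_fun do rewrite -mulNr|under eq_fun do rewrite -mulNr].
Qed.

Lemma norm_rot_le (c s p q : R) : `|c| <= 1 -> `|s| <= 1 ->
  `|c * p + s * q| <= `|p| + `|q|.
Proof.
move=> hc hs; apply: le_trans (ler_normD _ _) _.
by rewrite !normrM lerD// ler_piMl.
Qed.

Lemma continuous_ft phi : cintegrable R [set: R] phi ->
  continuous (fun xi => complex.Re (ft phi xi)) /\
  continuous (fun xi => complex.Im (ft phi xi)).
Proof.
move=> iphi; have [i1 i2] := iphi.
have ig : mu.-integrable [set: R] (EFin \o
    (fun t => `|complex.Re (phi t)| + `|complex.Im (phi t)|)).
  have := integrableD measurableT (integrable_norm i1) (integrable_norm i2).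
  by apply: eq_integrable.
have cs1 (x : R) : `|cos x| <= 1 by rewrite ler_norml cos_geN1 cos_le1.
have sn1 (x : R) : `|sin x| <= 1 by rewrite ler_norml sin_geN1 sin_le1.
have cont (F : R -> R -> R) :
    (forall x, mu.-integrable [set: R] (EFin \o F x)) ->
    (forall t, continuous (F ^~ t)) ->
    (forall x t, `|F x t| <= `|complex.Re (phi t)| + `|complex.Im (phi t)|) ->
    continuous (fun x => \int[mu]_t F x t)%R.
  move=> iF cF bF x.
  apply: (@continuity_under_integral _ _ _ mu F setT measurableT
    (x - 1) (x + 1) _ _ _ ig _ x).
  - by move=> y _; exact: iF.
  - by apply: aeW => t _ y _; exact: cF.
  - by move=> y _; apply: aeW => t _; exact: bF.
  - by rewrite inE/= in_itv/= ltrBlDr ltrDl ltr01.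
pose a : R := (Num.sqrt (2 * pi))^-1.
split.
- rewrite (_ : (fun xi => _) = fun xi => a * (\int[mu]_t
    complex.Re (expi (- (2 * pi * t * xi)) * phi t))%R); last first.
    by apply/funext => xi; rewrite ReM Re_cintegral /= mul0r subr0.
  move=> x; apply: cvgM; first exact: cvg_cst.
  apply: cont => {x}.
  + by move=> x; have [] := cintegrable_ft _ x iphi.
  + move=> t x; under eq_fun do rewrite ReM /=.
    have [cc cs] := continuous_cos_sin_ft t.
    by apply: cvgB; apply: cvgM;
      [exact: cc|exact: cvg_cst|exact: cs|exact: cvg_cst].
  + by move=> x t; rewrite ReM -[X in `|_ + X|]mulNr norm_rot_le/= ?normrN.
- rewrite (_ : (fun xi => _) = fun xi => a * (\int[mu]_t
    complex.Im (expi (- (2 * pi * t * xi)) * phi t))%R); last first.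
    by apply/funext => xi; rewrite ImM Im_cintegral /= mul0r addr0.
  move=> x; apply: cvgM; first exact: cvg_cst.
  apply: cont => {x}.
  + by move=> x; have [] := cintegrable_ft _ x iphi.
  + move=> t x; under eq_fun do rewrite ImM /=.
    have [cc cs] := continuous_cos_sin_ft t.
    by apply: cvgD; apply: cvgM;
      [exact: cc|exact: cvg_cst|exact: cs|exact: cvg_cst].
  + by move=> x t; rewrite ImM /= addrC norm_rot_le.
Qed.

Lemma continuous_cnorm2_ft phi : cintegrable R [set: R] phi ->
  continuous (fun xi => cnorm2 (ft phi xi)).
Proof.
move=> /continuous_ft[cR cI] x; apply: cvgD.
- by under eq_fun do rewrite expr2; apply: cvgM; exact: cR.
- by under eq_fun do rewrite expr2; apply: cvgM; exact: cI.
Qed.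

End FourierTransform.

(** * The pole of the weight *)

Section Substitution.
Variable R : realType.
Local Notation mu := (@lebesgue_measure R).
Implicit Types g : R -> R.

Lemma measurable_invr : measurable_fun [set: R] (fun x : R => x^-1).
Proof.
rewrite -(setUv [set (0 : R)]).
apply/measurable_funU; [exact: measurable_set1| |split].
- by apply: measurableC; exact: measurable_set1.
- exact: measurable_fun_set1.
- apply: open_continuous_measurable_fun.
    rewrite openC; apply: accessible_closed_set1.
    exact: (hausdorff_accessible (@Rhausdorff R)).
  by move=> x /[!inE]/= /eqP x0; exact: inv_continuous.
Qed.

Lemma measurable_div_norm g (c : R) : measurable_fun [set: R] g ->
  measurable_fun [set: R] (fun x => g x / `|c + x|).
Proof.
move=> mg; apply: measurable_funM => //.
apply: (@measurableT_comp _ _ _ _ _ _ (fun x : R => x^-1)).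
  exact: measurable_invr.
by apply: measurableT_comp => //; apply: measurable_funD.
Qed.

Lemma integral_divergent_pole g : continuous g -> (forall x, 0 <= g x) ->
  (\int[mu]_x (g x / `|1 + x|)%:E < +oo)%E -> g (-1) = 0.
Proof.
move=> cg g0 fin; apply/eqP/negPn/negP => gN1.
have gp : 0 < g (-1) by rewrite lt_def gN1 g0.
pose c := g (-1) / 2.
have cp : 0 < c by rewrite divr_gt0.
have [d /= d0 hd] : \forall x \near (-1 : R), c < g x.
  have cN1 : g x @[x --> (-1 : R)] --> g (-1) by exact: cg.
  by apply: (cvgr_gt (g (-1)) cN1); rewrite /c ltr_pdivrMr// ltr_pMr// ltr1n.
pose M := fine (\int[mu]_x (g x / `|1 + x|)%:E)%E.
have M0 : 0 <= M.
  by apply: fine_ge0; apply: integral_ge0 => x _; rewrite lee_fin divr_ge0.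
pose b := d / 2; pose a := b * expR (- ((M + 1) / c)).
have b0 : 0 < b by rewrite divr_gt0.
have a0 : 0 < a by rewrite mulr_gt0 ?expR_gt0.
have ab : a < b.
  rewrite /a gtr_pMr// -expR0 ltr_expR oppr_lt0 divr_gt0//.
  by rewrite ltr_wpDl.
have mg : measurable_fun [set: R] (fun x => g x / `|1 + x|).
  by apply: measurable_div_norm; exact: continuous_measurable_fun.
pose I := (`[-1 + a, -1 + b]%classic : set R).
have mI : measurable I by exact: measurable_itv.
have posI (x : R) : x \in `[-1 + a, -1 + b]%R -> 0 < 1 + x.
  rewrite in_itv/= => /andP[h _]; lra.
have dln (x : R) : 0 < 1 + x ->
    is_derive x (1 : R) (c \*: (@ln R \o +%R 1)) (c * (1 + x)^-1).
  move=> x1.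
  have d1 : is_derive x (1 : R) (+%R 1) (1 : R).
    rewrite [X in is_derive _ _ X _](_ : _ = cst 1 \+ @id R)//.
    apply: (is_derive_eq (is_deriveD (is_derive_cst _ _ _) (is_derive_id _ _))).
    by rewrite add0r.
  apply: (is_derive_eq (is_deriveZ _ (is_derive1_comp (is_derive1_ln x1) d1))).
  by rewrite /GRing.scale/= mulr1.
have cinv : {within I, continuous (fun x => c * (1 + x)^-1)}.
  apply: continuous_in_subspaceT => x /[!inE]/= /posI x1.
  apply: cvgM; first exact: cvg_cst.
  apply: cvgV; first by rewrite gt_eqF.
  by apply: cvgD; [exact: cvg_cst|exact: cvg_id].
have key : (\int[mu]_(x in I) (c * (1 + x)^-1)%:E = (M + 1)%:E)%E.
  rewrite (@continuous_FTC2 _ _ (c \*: (@ln R \o +%R 1)))//.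
  - have lna : ln a = ln b - (M + 1) / c.
      by rewrite /a lnM ?posrE ?expR_gt0// expRK.
    rewrite -EFinB /GRing.scale/= !addrA subrr !add0r lna.
    congr EFin; rewrite -scalerBr.
    rewrite [LHS](_ : _ = c * (ln b - (ln b - (M + 1) / c)))//.
    by field; rewrite gt_eqF.
  - lra.
  - have cF (x : R) : 0 < 1 + x -> {for x, continuous (c \*: (@ln R \o +%R 1))}.
      move=> x1; apply: differentiable_continuous; apply/derivable1_diffP.
      by have [] := dln x x1.
    split.
    + move=> x xI; have [] // := dln x _.
      by apply: posI; apply: subset_itv_oo_cc.
    + by apply: cvg_at_right_filter; apply: cF; lra.
    + by apply: cvg_at_left_filter; apply: cF; lra.
  - move=> x xI; rewrite derive1E; have [] // := dln x _.
    by apply: posI; apply: subset_itv_oo_cc.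
have : ((M + 1)%:E <= M%:E)%E.
  rewrite -key /M fineK; last first.
    by rewrite ge0_fin_numE// integral_ge0// => x _; rewrite lee_fin divr_ge0.
  apply: (@le_trans _ _ (\int[mu]_(x in I) (g x / `|1 + x|)%:E)%E).
    apply: ge0_le_integral => //.
    - move=> x xI; have x1 := posI x xI.
      by rewrite lee_fin mulr_ge0 ?invr_ge0 ?(ltW cp) ?(ltW x1).
    - apply/measurable_EFinP; exact: (subspace_continuous_measurable_fun mI cinv).
    - by apply/measurable_EFinP; exact: measurable_funTS.
    - move=> x xI; have x1 := posI x xI.
      rewrite lee_fin gtr0_norm// ler_wpM2r ?invr_ge0 ?(ltW x1)// ltW//.
      apply: hd; move: xI x1; rewrite /I/= in_itv/= /b => /andP[h1 h2] x1.
      by rewrite ltr_norml; apply/andP; split; lra.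
  apply: ge0_subset_integral => //.
  - exact/measurable_EFinP.
  - by move=> x _; rewrite lee_fin divr_ge0.
by rewrite lee_fin; lra.
Qed.

End Substitution.

(** * The substitution [eta = k / xi - 1] *)

Section Inversion.
Variable R : realType.
Local Notation mu := (@lebesgue_measure R).
Implicit Types g : R -> R.

Lemma is_derive_inversion (k x : R) : x != 0 ->
  is_derive x (1 : R) (fun y => k / y - 1) (- (k / x ^+ 2)).
Proof.
move=> x0.
rewrite [X in is_derive _ _ X _](_ : _ =
  (k \*: (fun y : R => y^-1)) \+ cst (-1)); last by apply/funext => y.
have dV : is_derive x (1 : R) (fun y : R => y^-1) (- x ^- 2 *: (1 : R)).
  exact: (is_deriveV x0 (is_derive_id _ _)).
apply: (is_derive_eq (is_deriveD (is_deriveZ k dV) (is_derive_cst _ _ _))).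
by rewrite /GRing.scale/= mulr1 addr0 mulrN.
Qed.

Lemma integral_inversion_segment g (k a b : R) : continuous g -> 0 < k ->
  a <= b -> (0 < a) || (b < 0) ->
  (\int[mu]_(x in `[a, b]) (g (k / x - 1) / `|x|)%:E =
   \int[mu]_(y in `[(k / b - 1)%R, (k / a - 1)%R]) (g y / `|1 + y|)%:E)%E.
Proof.
move=> cg k0 ab sgn.
pose F := fun y : R => k / y - 1.
have nz (x : R) : x \in `[a, b]%R -> x != 0.
  rewrite in_itv/= => /andP[ax xb]; case/orP: sgn => h.
    by rewrite gt_eqF// (lt_le_trans h).
  by rewrite lt_eqF// (le_lt_trans xb).
have a0 : a != 0 by apply: nz; rewrite in_itv/= lexx.
have b0 : b != 0 by apply: nz; rewrite in_itv/= lexx ab.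
have dF (x : R) : x != 0 -> F^`() x = - (k / x ^+ 2).
  by move=> x0; rewrite derive1E; have [] := is_derive_inversion k x x0.
have cF (x : R) : x != 0 -> {for x, continuous F}.
  move=> x0; apply: differentiable_continuous; apply/derivable1_diffP.
  by have [] := is_derive_inversion k x x0.
have cdF (x : R) : x != 0 -> {for x, continuous F^`()}.
  move=> x0; rewrite /prop_for /continuous_at dF//.
  have : - (k / y ^+ 2) @[y --> x] --> - (k / x ^+ 2).
    apply: cvgN; apply: cvgM; first exact: cvg_cst.
    apply: cvgV; first by rewrite expf_neq0.
    by apply: cvgM; exact: cvg_id.
  apply: cvg_trans; apply: near_eq_cvg.
  have := @open_neq R 0.
  rewrite openE => /(_ x x0); apply: filterS => y /= y0.
  by rewrite dF.
rewrite (@integration_by_substitution_decreasing _ F)//.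
- apply: eq_integral => /= x; rewrite inE => xI; congr EFin.
  have {xI}x0 := nz (x : R) xI; move: (x : R) x0 => {}x x0.
  rewrite [RHS](_ : _ = g (F x) / `|1 + F x| * - derive1 F x)// dF//.
  have -> : 1 + F x = k / x by rewrite /F addrC subrK.
  rewrite opprK normrM normfV (gtr0_norm k0).
  have xx : x ^+ 2 = `|x| ^+ 2 by rewrite -normrX ger0_norm ?sqr_ge0.
  rewrite /F xx; field.
  by rewrite normr_eq0 x0 gt_eqF.
- move=> x y xI yI xy; rewrite /F ltrD2r ltr_pM2l//.
  have xyp : 0 < x * y.
    by move: xI yI; rewrite !in_itv/= => /andP[? ?] /andP[? ?];
      case/orP: sgn => h; nra.
  rewrite -subr_gt0.
  have -> : y^-1 - x^-1 = (x - y) / (x * y).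
    by field; rewrite (nz x)// (nz y).
  by rewrite divr_gt0// subr_gt0.
- by move=> x xI; apply: cdF; apply: nz; apply: subset_itv_oo_cc.
- apply/cvg_ex; exists (F^`() a); apply: cvg_at_right_filter; exact: cdF.
- apply/cvg_ex; exists (F^`() b); apply: cvg_at_left_filter; exact: cdF.
- split.
  + move=> x xI; have [] // := is_derive_inversion k x _.
    by apply: nz; apply: subset_itv_oo_cc.
  + by apply: cvg_at_right_filter; exact: cF.
  + by apply: cvg_at_left_filter; exact: cF.
- apply: continuous_in_subspaceT => y; rewrite inE/= in_itv/= /F => /andP[h1 h2].
  have y1 : `|1 + y| != 0.
    rewrite normr_eq0; case/orP: sgn => h.
      have : 0 < k / b by rewrite divr_gt0// (lt_le_trans h).
      by move=> ?; rewrite gt_eqF//; lra.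
    have : k / a < 0 by rewrite pmulr_rlt0// invr_lt0 (le_lt_trans ab).
    by move=> ?; rewrite lt_eqF//; lra.
  apply: cvgM; first exact: cg.
  apply: cvgV => //.
  by apply: cvg_norm; apply: cvgD; [exact: cvg_cst|exact: cvg_id].
Qed.

End Inversion.

Section InversionLine.
Variable R : realType.
Local Notation mu := (@lebesgue_measure R).
Implicit Types g u : R -> R.

Lemma integral_exhaustion_le u (F : (set R)^nat) (M : \bar R) :
  {homo F : n m / (n <= m)%N >-> n `<=` m} ->
  (forall n, measurable (F n)) -> measurable_fun [set: R] u ->
  (forall x, 0 <= u x) ->
  (forall n, (\int[mu]_(x in F n) (u x)%:E <= M)%E) ->
  (\int[mu]_(x in \bigcup_n F n) (u x)%:E <= M)%E.
Proof.
move=> ndF mF mu_ u0 bF.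
have : (\int[mu]_(x in F n) (u x)%:E @[n --> \oo] -->
    \int[mu]_(x in \bigcup_n F n) (u x)%:E)%E.
  apply: ge0_nondecreasing_set_cvg_integral => //.
  - by move=> n m nm; apply/subsetPset; exact: ndF.
  - by move=> n; apply/measurable_EFinP; exact: measurable_funTS.
  - by move=> n x _; rewrite lee_fin.
move=> cF; rewrite -(cvg_lim _ cF)//; apply: lime_le; last exact: nearW.
by apply/cvg_ex; eexists; exact: cF.
Qed.

Let iv (n : nat) : R := n.+1%:R^-1.

Let iv_gt0 n : 0 < iv n. Proof. by rewrite invr_gt0. Qed.

Let iv_le1 n : iv n <= 1. Proof. by rewrite invf_le1// ler1n. Qed.

Let iv_le n : iv n <= n.+1%:R. Proof. by rewrite (le_trans (iv_le1 n))// ler1n. Qed.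

Let iv_homo n m : (n <= m)%N -> iv m <= iv n.
Proof. by move=> nm; rewrite lef_pV2 ?posrE// ler_nat. Qed.

Lemma bigcup_itv_pos :
  \bigcup_n `[iv n, n.+1%:R]%classic = `]0, +oo[%classic :> set R.
Proof.
apply/seteqP; split => x /=.
  by move=> [n _]/=; rewrite !in_itv/= andbT => /andP[h _]; exact: lt_le_trans h.
rewrite in_itv/= andbT => x0.
have y0 : 0 < x^-1 by rewrite invr_gt0.
have := truncnS_gt (x + x^-1); set n := Num.truncn _ => hn.
exists n => //=; rewrite in_itv/=; apply/andP; split; last by lra.
rewrite -[x]invrK lef_pV2 ?posrE//; lra.
Qed.

Lemma bigcup_itv_neg :
  \bigcup_n `[- n.+1%:R, - iv n]%classic = `]-oo, 0[%classic :> set R.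
Proof.
apply/seteqP; split => x /=.
  move=> [n _]/=; rewrite !in_itv/= => /andP[_ h].
  by have := iv_gt0 n; lra.
rewrite in_itv/= => x0.
have : (`]0%R, +oo[%classic : set R) (- x) by rewrite /= in_itv/= andbT oppr_gt0.
rewrite -bigcup_itv_pos => -[n _] /=; rewrite in_itv/= => /andP[h1 h2].
by exists n => //=; rewrite in_itv/=; apply/andP; split; lra.
Qed.

Lemma measurable_inversion g (k : R) : measurable_fun [set: R] g ->
  measurable_fun [set: R] (fun x => g (k / x - 1)).
Proof.
move=> mg; apply: (@measurableT_comp _ _ _ _ _ _ g) => //.
apply: measurable_funB => //; apply: measurable_funM => //.
exact: measurable_invr.
Qed.

Lemma measurable_inversion_div g (k : R) : measurable_fun [set: R] g ->
  measurable_fun [set: R] (fun x => g (k / x - 1) / `|x|).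
Proof.
move=> mg; under eq_fun => x do rewrite -[X in `|X|]add0r.
by apply: measurable_div_norm; exact: measurable_inversion.
Qed.

Lemma integral_inversion_le_pos g (k : R) : continuous g ->
  (forall x, 0 <= g x) -> 0 < k ->
  (\int[mu]_x (g (k / x - 1) / `|x|)%:E <= \int[mu]_y (g y / `|1 + y|)%:E)%E.
Proof.
move=> cg g0 k0.
have mg : measurable_fun [set: R] g by exact: continuous_measurable_fun.
have mh := measurable_inversion_div g k mg.
have mH := measurable_div_norm R g 1 mg.
have h0 (x : R) : (0 <= (g (k / x - 1) / `|x|)%:E)%E.
  by rewrite lee_fin divr_ge0.
have H0 (x : R) : (0 <= (g x / `|1 + x|)%:E)%E by rewrite lee_fin divr_ge0.
have posP : (\int[mu]_(x in `]0%R, +oo[) (g (k / x - 1) / `|x|)%:E <=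
             \int[mu]_(y in `](-1)%R, +oo[) (g y / `|1 + y|)%:E)%E.
  rewrite -bigcup_itv_pos; apply: integral_exhaustion_le => //.
  - move=> n m nm x /=; rewrite !in_itv/= => /andP[h1 h2]; apply/andP; split.
      exact: le_trans (iv_homo _ _ nm) h1.
    by apply: le_trans h2 _; rewrite ler_nat.
  move=> n; rewrite integral_inversion_segment//; last by rewrite iv_gt0.
  apply: ge0_subset_integral => //.
  - by apply/measurable_EFinP; exact: measurable_funTS.
  - move=> x /=; rewrite !in_itv/= andbT => /andP[h _].
    by apply: lt_le_trans h; rewrite ltrBrDr addNr divr_gt0.
have negP : (\int[mu]_(x in `]-oo, 0%R[) (g (k / x - 1) / `|x|)%:E <=
             \int[mu]_(y in `]-oo, (-1)%R]) (g y / `|1 + y|)%:E)%E.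
  rewrite -bigcup_itv_neg; apply: integral_exhaustion_le => //.
  - move=> n m nm x /=; rewrite !in_itv/= => /andP[h1 h2]; apply/andP; split.
      by apply: le_trans h1; rewrite lerN2 ler_nat.
    by apply: le_trans h2 _; rewrite lerN2 iv_homo.
  move=> n; rewrite integral_inversion_segment//; first last.
  - by rewrite oppr_lt0 iv_gt0 orbT.
  - by rewrite lerN2.
  apply: ge0_subset_integral => //.
  - by apply/measurable_EFinP; exact: measurable_funTS.
  - move=> x /=; rewrite !in_itv/= => /andP[_ h].
    apply: le_trans h _.
    by rewrite invrN mulrN lerBlDr addNr oppr_le0 ltW// divr_gt0.
have splitR (c : R) (v : R -> R) : measurable_fun [set: R] v ->
    (forall x, 0 <= (v x)%:E)%E ->
    (\int[mu]_x (v x)%:E = \int[mu]_(x in `]-oo, c]) (v x)%:E +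
      \int[mu]_(x in `]c, +oo[) (v x)%:E)%E.
  move=> mv v0.
  have e : [set: R] = `]-oo, c]%classic `|` `]c, +oo[%classic.
    apply/seteqP; split => // x _ /=; rewrite !in_itv/= andbT.
    by case: (leP x c) => ?; [left|right].
  rewrite [in LHS]e ge0_integral_setU//.
  - by rewrite -e; exact/measurable_EFinP.
  - apply/disj_setPS => x /= []; rewrite !in_itv/= andbT => h1 h2.
    by move: (le_lt_trans h1 h2); rewrite ltxx.
rewrite (splitR 0)// (splitR (-1) (fun x => g x / `|1 + x|))//.
apply: leeD => //.
rewrite -integral_itv_bndo_bndc//.
by apply/measurable_EFinP; exact: measurable_funTS.
Qed.

Lemma ge0_integral_reflection u : measurable_fun [set: R] u ->
  (forall x, 0 <= u x) ->
  (\int[mu]_x (u x)%:E = \int[mu]_x (u (- x))%:E)%E.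
Proof.
move=> mu_ u0.
have -> : (\int[mu]_x (u x)%:E =
  \int[pushforward mu (-%R : R -> measurableTypeR R)]_x (u x)%:E)%E.
  by apply: eq_measure_integral => //= A mA AS; exact/esym/lebesgue_measureN.
rewrite ge0_integral_pushforward//.
- exact/measurable_EFinP.
- by move=> x _; rewrite lee_fin.
Qed.

Lemma integral_inversion_le g (k : R) : continuous g ->
  (forall x, 0 <= g x) -> k != 0 ->
  (\int[mu]_x (g (k / x - 1) / `|x|)%:E <= \int[mu]_y (g y / `|1 + y|)%:E)%E.
Proof.
move=> cg g0; case: (ltgtP k 0) => // k0 _; last exact: integral_inversion_le_pos.
rewrite ge0_integral_reflection.
- apply: le_trans (integral_inversion_le_pos g (- k) cg g0 _); last by rewrite oppr_gt0.
  under eq_integral do rewrite normrN invrN mulrN -mulNr.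
  exact: lexx.
- by apply: measurable_inversion_div; exact: continuous_measurable_fun.
- by move=> x; rewrite divr_ge0.
Qed.

Lemma Ycoef_ft_le (phi : R -> R[i]) (k : int) :
  cintegrable R [set: R] phi -> (Znorm2 phi < +oo)%E ->
  (Ycoef_norm2 (fun xi : R => ft phi ((k%:~R - xi) / xi)) <= Znorm2 phi)%E.
Proof.
move=> iphi fin; pose g xi := cnorm2 (ft phi xi).
have cg : continuous g := continuous_cnorm2_ft R phi iphi.
have g0 x : 0 <= g x by exact: cnorm2_ge0.
have -> : Ycoef_norm2 (fun xi : R => ft phi ((k%:~R - xi) / xi)) =
  (\int[mu]_x (g (k%:~R / x - 1) / `|x|)%:E)%E.
  apply: eq_integral => x _; congr EFin.
  have [->|x0] := eqVneq x 0; first by rewrite normr0 invr0 !mulr0.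
  by rewrite mulrBl divff.
have [k0|k0] := eqVneq k 0; last first.
  by apply: integral_inversion_le => //; rewrite intr_eq0.
have gN1 := integral_divergent_pole R g cg g0 fin.
rewrite (_ : (\int[mu]_x _)%E = 0%E).
  by apply: integral_ge0 => x _; rewrite lee_fin divr_ge0 ?cnorm2_ge0.
apply: integral0_eq => x _.
by rewrite k0 mulr0z mul0r sub0r gN1 mul0r.
Qed.

End InversionLine.

(** * The map S *)

Section ContinuityOfS.
Variable R : realType.
Local Notation mu := (@lebesgue_measure R).
Local Notation I01 := (`[0%R, 1%R]%classic : set R).
Local Notation energy f := (\int[mu]_(t in I01) cnorm2 (f t))%R.
Implicit Types f phi u v : R -> R[i].

Lemma measurable_weighted_cnorm2 u (c : R) : cmeasurable [set: R] u ->
  measurable_fun [set: R] (fun x => (cnorm2 (u x) / `|c + x|)%:E).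
Proof.
move=> mu_; apply/measurable_EFinP; apply: measurable_div_norm.
exact: measurable_cnorm2.
Qed.

Lemma weighted_cnorm2_ge0 u (c : R) x : (0 <= (cnorm2 (u x) / `|c + x|)%:E)%E.
Proof. by rewrite lee_fin divr_ge0 ?cnorm2_ge0. Qed.

Lemma integral_weighted_cnorm2D u v (c : R) :
  cmeasurable [set: R] u -> cmeasurable [set: R] v ->
  (\int[mu]_x (cnorm2 (u x + v x) / `|c + x|)%:E <=
   2%:E * \int[mu]_x (cnorm2 (u x) / `|c + x|)%:E +
   2%:E * \int[mu]_x (cnorm2 (v x) / `|c + x|)%:E)%E.
Proof.
move=> mu_ mv.
have m1 := measurable_weighted_cnorm2 _ c mu_.
have m2 := measurable_weighted_cnorm2 _ c mv.
have m3 := measurable_weighted_cnorm2 _ c (cmeasurableD _ _ _ _ mu_ mv).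
have p1 := weighted_cnorm2_ge0 u c; have p2 := weighted_cnorm2_ge0 v c.
rewrite -!ge0_integralZl// -ge0_integralD//.
- apply: ge0_le_integral => //.
  + by move=> x _; exact: (weighted_cnorm2_ge0 (fun x => u x + v x)).
  + by apply: emeasurable_funD; exact: measurable_funeM.
  + move=> x _; rewrite -!EFinM -EFinD lee_fin !mulrA -mulrDl.
    by rewrite ler_wpM2r ?invr_ge0// cnorm2D_le.
- by move=> x _; rewrite mule_ge0.
- exact: measurable_funeM.
- by move=> x _; rewrite mule_ge0.
- exact: measurable_funeM.
Qed.

Lemma Ycoef_norm2D u v : cmeasurable [set: R] u -> cmeasurable [set: R] v ->
  (Ycoef_norm2 (fun x => u x + v x)%R <=
   2%:E * Ycoef_norm2 u + 2%:E * Ycoef_norm2 v)%E.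
Proof.
move=> mu_ mv; have := integral_weighted_cnorm2D u v 0 mu_ mv.
have e w : (\int[mu]_x (cnorm2 (w x) / `|0 + x|)%:E = Ycoef_norm2 w)%E.
  by apply: eq_integral => x _; rewrite add0r.
by rewrite !e.
Qed.

Lemma cmeasurable_ft_inversion phi (k : R) : cmeasurable [set: R] (ft phi) ->
  cmeasurable [set: R] (fun xi => (ft phi ((k - xi) / xi))^*).
Proof.
have mI : measurable_fun [set: R] (fun xi : R => (k - xi) / xi).
  apply: measurable_funM; last exact: measurable_invr.
  exact: measurable_funB.
move=> [m1 m2]; split.
- under eq_fun do rewrite ReJ.
  exact: (measurableT_comp m1 mI).
- under eq_fun do rewrite ImJ.
  by apply: measurable_funN; exact: (measurableT_comp m2 mI).
Qed.

Lemma cmeasurable_Scoef f phi k : cmeasurable [set: R] (ft phi) ->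
  cmeasurable [set: R] (Scoef f phi k).
Proof.
move=> m; apply: cmeasurableM; first exact: cmeasurable_cst.
exact: cmeasurable_ft_inversion.
Qed.

Lemma Znorm2_ge0 phi : (0 <= Znorm2 phi)%E.
Proof. by apply: integral_ge0 => x _; exact: weighted_cnorm2_ge0. Qed.

Lemma Ycoef_norm2_ge0 u : (0 <= Ycoef_norm2 u)%E.
Proof.
by apply: integral_ge0 => x _; rewrite lee_fin divr_ge0 ?cnorm2_ge0.
Qed.

Lemma Ycoef_Scoef_le f phi k : cintegrable R [set: R] phi -> inZ phi ->
  (Ycoef_norm2 (Scoef f phi k) <= (cnorm2 (fcoef f k))%:E * Znorm2 phi)%E.
Proof.
move=> iphi [mphi fin].
have mj := cmeasurable_ft_inversion phi k%:~R mphi.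
have e : Ycoef_norm2 (Scoef f phi k) = ((cnorm2 (fcoef f k))%:E *
    Ycoef_norm2 (fun xi : R => ft phi ((k%:~R - xi) / xi)))%E.
  rewrite -ge0_integralZl ?lee_fin ?cnorm2_ge0//.
  - apply: eq_integral => x _.
    by rewrite /Scoef cnorm2M cnorm2J -EFinM mulrA.
  - have := measurable_weighted_cnorm2 _ 0 mj.
    by under eq_fun do rewrite cnorm2J add0r.
  - by move=> x _; rewrite lee_fin divr_ge0 ?cnorm2_ge0.
rewrite e lee_wpmul2l ?lee_fin ?cnorm2_ge0//.
exact: Ycoef_ft_le.
Qed.

Lemma esum_fcoef_le f (z : \bar R) : L2_01 f -> (0 <= z)%E ->
  (\esum_(k in [set: int]) ((cnorm2 (fcoef f k))%:E * z) <=
   (energy f)%:E * z)%E.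
Proof.
move=> hf z0; apply: ge_ereal_sup => _ [A [finA _] <-].
rewrite fsbig_finite//= -ge0_sume_distrl; last first.
  by move=> k _; rewrite lee_fin cnorm2_ge0.
rewrite lee_wpmul2r// sumEFin lee_fin.
by apply: bessel_seq => //; exact: finmap.fset_uniq.
Qed.

Lemma Ynorm2_Scoef_le f phi : L2_01 f -> cintegrable R [set: R] phi ->
  inZ phi -> (Ynorm2 (Scoef f phi) <= (energy f)%:E * Znorm2 phi)%E.
Proof.
move=> hf iphi hphi; apply: le_trans (esum_fcoef_le f _ hf (Znorm2_ge0 phi)).
by apply: le_esum => k _; exact: Ycoef_Scoef_le.
Qed.

Lemma fcoefB f g k : L2_01 f -> L2_01 g ->
  fcoef (fun t => f t - g t) k = fcoef f k - fcoef g k.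
Proof.
move=> hf hg; rewrite fcoefD//; last exact: L2_01N.
congr (_ + _); rewrite -mulN1r -fcoefZ//.
by apply: (congr1 (fun h => fcoef h k)); apply/funext => t; rewrite mulN1r.
Qed.

Lemma energyD f g : L2_01 f -> L2_01 g ->
  energy (fun t => f t + g t) <= 2 * energy f + 2 * energy g.
Proof.
move=> hf hg.
have if_ := L2_01_integrable_cnorm2 R f hf.
have ig := L2_01_integrable_cnorm2 R g hg.
rewrite -Rintegral_lincomb//; apply: le_Rintegral => //.
- exact: L2_01_integrable_cnorm2 (L2_01D _ _ _ hf hg).
- exact: integrable_lincomb.
- by move=> x _; exact: cnorm2D_le.
Qed.

Lemma inZ_sub phi psi : cintegrable R [set: R] phi ->
  cintegrable R [set: R] psi -> inZ phi -> inZ psi ->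
  inZ (fun t => phi t - psi t).
Proof.
move=> iphi ipsi [mphi fphi] [mpsi fpsi].
have e : ft (fun t => phi t - psi t) = fun xi => ft phi xi + (-1) * ft psi xi.
  by apply/funext => xi; rewrite ftB// mulN1r.
have mN : cmeasurable [set: R] (fun xi => (-1) * ft psi xi).
  by apply: cmeasurableM => //; exact: cmeasurable_cst.
split; first by rewrite e; exact: cmeasurableD.
rewrite /Znorm2 e.
apply: le_lt_trans (integral_weighted_cnorm2D _ _ 1 mphi mN) _.
have -> : (\int[mu]_x (cnorm2 (-1 * ft psi x) / `|1 + x|)%:E = Znorm2 psi)%E.
  by apply: eq_integral => x _; rewrite mulN1r cnorm2N.
have lt2 (z : \bar R) : (0 <= z -> z < +oo -> 2%:E * z < +oo)%E.
  by move=> z0 zy; exact: lte_mul_pinfty.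
apply: lte_add_pinfty; apply: lt2.
- exact: Znorm2_ge0.
- exact: fphi.
- exact: Znorm2_ge0.
- exact: fpsi.
Qed.

Lemma Scoef_sub f f' phi phi' k xi : L2_01 f -> L2_01 f' ->
  cintegrable R [set: R] phi -> cintegrable R [set: R] phi' ->
  Scoef f phi k xi - Scoef f' phi' k xi =
  Scoef (fun t => f t - f' t) phi k xi +
  Scoef f' (fun t => phi t - phi' t) k xi.
Proof.
move=> hf hf' i i'; rewrite /Scoef fcoefB// ftB//.
by rewrite rmorphB [X in _ = X + _]mulrBl mulrBr subrKA.
Qed.

Lemma Ynorm2_Scoef_sub_le f f' phi phi' : L2_01 f -> L2_01 f' ->
  cintegrable R [set: R] phi -> cintegrable R [set: R] phi' ->
  inZ phi -> inZ phi' ->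
  (Ynorm2 (fun k xi => (Scoef f phi k xi - Scoef f' phi' k xi)%R) <=
   (energy (fun t => f t - f' t)%R)%:E * (2%:E * Znorm2 phi) +
   (energy f')%:E * (2%:E * Znorm2 (fun t => phi t - phi' t)%R))%E.
Proof.
move=> hf hf' i i' hphi hphi'.
have hd := inZ_sub _ _ i i' hphi hphi'.
have hdf : L2_01 (fun t => f t - f' t) by apply: L2_01D => //; exact: L2_01N.
have idf : cintegrable R [set: R] (fun t => phi t - phi' t).
  have := cintegrableD _ _ _ _ measurableT i
    (cintegrableZ R _ (-1) _ measurableT i').
  by under eq_fun do rewrite mulN1r.
have [md _] := hd; have [mphi _] := hphi.
have Z2 (psi : R -> R[i]) : (0 <= 2%:E * Znorm2 psi)%E.
  by apply: mule_ge0 => //; exact: Znorm2_ge0.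
apply: le_trans (leeD (esum_fcoef_le _ _ hdf (Z2 _))
                      (esum_fcoef_le _ _ hf' (Z2 _))).
rewrite -esumD; last 2 first.
- by move=> k _; rewrite mule_ge0// lee_fin cnorm2_ge0.
- by move=> k _; rewrite mule_ge0// lee_fin cnorm2_ge0.
apply: le_esum => k _.
rewrite (_ : (fun xi => _) = fun xi =>
  Scoef (fun t => f t - f' t) phi k xi +
  Scoef f' (fun t => phi t - phi' t) k xi); last first.
  by apply/funext => xi; exact: Scoef_sub.
apply: le_trans (Ycoef_norm2D _ _ _ _) _; try exact: cmeasurable_Scoef.
rewrite muleCA [X in (_ <= _ + X)%E]muleCA.
by apply: leeD; rewrite lee_wpmul2l//; exact: Ycoef_Scoef_le.
Qed.

Definition modulus (eps z e : R) := Num.min 1 (eps / (2 * z + 4 * e + 4)).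

Lemma modulus_gt0 (eps z e : R) : 0 < eps -> 0 <= z -> 0 <= e ->
  0 < modulus eps z e.
Proof. by move=> eps0 z0 e0; rewrite lt_min ltr01 divr_gt0//; lra. Qed.

Lemma modulus_bound (eps z e ed e' zd y : R) (d := modulus eps z e) :
  0 < eps -> 0 <= z -> 0 <= e -> 0 <= e' -> 0 <= zd ->
  ed < d ^+ 2 -> zd < d ^+ 2 -> e' <= 2 * e + 2 * ed ->
  y <= ed * (2 * z) + e' * (2 * zd) -> y < eps ^+ 2.
Proof.
move=> eps0 z0 e0 e'0 zd0 hed hzd he' hy.
have d0 : 0 < d by exact: modulus_gt0.
pose K := 2 * z + 4 * e + 4; have K4 : 4 <= K by rewrite /K; lra.
have K0 : 0 < K by lra.
have d1 : d <= 1 by rewrite ge_min lexx.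
have dK : d * K <= eps by rewrite -ler_pdivlMr// ge_min lexx orbT.
have d21 : d ^+ 2 <= 1 by rewrite expr_le1// ltW.
have bound : y <= d ^+ 2 * K.
  apply: le_trans hy _.
  have t1 : ed * (2 * z) <= d ^+ 2 * (2 * z).
    by rewrite ler_wpM2r ?mulr_ge0// ltW.
  have t2 : e' * (2 * zd) <= (2 * e + 2) * (2 * d ^+ 2).
    by apply: ler_pM; lra.
  by rewrite /K; lra.
have : (d * K) ^+ 2 <= eps ^+ 2.
  by rewrite lerXn2r ?nnegrE ?(ltW eps0) ?mulr_ge0 ?(ltW d0) ?(ltW K0).
have d2 : 0 < d ^+ 2 by rewrite exprn_gt0.
rewrite exprMn => h.
have h4 : 4 * (d ^+ 2 * K) <= d ^+ 2 * K ^+ 2.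
  by rewrite mulrCA ler_pM2l// expr2 ler_pM2r.
have dp : 0 < d ^+ 2 * K by rewrite mulr_gt0.
lra.
Qed.

End ContinuityOfS.

Theorem theorem4p1 (R : realType) :
  (* well defined: S(f, phi) lies in Y *)
  (forall f phi : R -> R[i],
      L2_01 f -> schwartz phi -> inZ phi -> inY (Scoef f phi)) /\
  (* continuous at every point of L^2([0,1]) x (Z cap S(R)) *)
  (forall f phi : R -> R[i],
      L2_01 f -> schwartz phi -> inZ phi ->
      forall eps : R, 0 < eps -> exists delta : R, 0 < delta /\
        forall f' phi' : R -> R[i],
          L2_01 f' -> schwartz phi' -> inZ phi' ->
          L2norm01 (fun t => f t - f' t) < delta ->
          Znorm (fun t => phi t - phi' t) < delta ->
          Ynorm (fun k xi => Scoef f phi k xi - Scoef f' phi' k xi) < eps).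
Proof.
split=> f phi hf /schwartz_cintegrable iphi hphi.
  have [mphi fphi] := hphi; split.
    move=> k; split; first exact: cmeasurable_Scoef.
    apply: le_lt_trans (Ycoef_Scoef_le _ _ _ _ iphi hphi) _.
    by rewrite lte_mul_pinfty ?lee_fin ?cnorm2_ge0.
  apply: le_lt_trans (Ynorm2_Scoef_le _ _ _ hf iphi hphi) _.
  rewrite lte_mul_pinfty// lee_fin; apply: Rintegral_ge0 => t _.
  exact: cnorm2_ge0.
move=> eps eps0.
set E := fun g : R -> R[i] =>
  (\int[@lebesgue_measure R]_(t in `[0%R, 1%R]) cnorm2 (g t))%R.
have E0 g : 0 <= E g by apply: Rintegral_ge0 => t _; exact: cnorm2_ge0.
have finZ (psi : R -> R[i]) : inZ psi -> Znorm2 psi = (fine (Znorm2 psi))%:E.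
  by move=> [_ h]; rewrite fineK// ge0_fin_numE ?Znorm2_ge0.
have z0 (psi : R -> R[i]) : 0 <= fine (Znorm2 psi) by exact/fine_ge0/Znorm2_ge0.
have d0 := modulus_gt0 _ eps (fine (Znorm2 phi)) (E f) eps0 (z0 phi) (E0 f).
exists (modulus _ eps (fine (Znorm2 phi)) (E f)); split=> //.
move=> f' phi' hf' /schwartz_cintegrable iphi' hphi'.
set d := modulus _ _ _ _ in d0 * => hfd hzd.
have hd := inZ_sub _ _ _ iphi iphi' hphi hphi'.
have sqrt_lt (x y : R) : 0 < y -> Num.sqrt x < y -> x < y ^+ 2.
  by move=> y0; rewrite -{1}[y]ger0_norm ?ltW// -sqrtr_sqr ltr_sqrt ?exprn_gt0.
have Ed : E (fun t => f t - f' t) < d ^+ 2 by exact: sqrt_lt.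
have Zd : fine (Znorm2 (fun t => phi t - phi' t)) < d ^+ 2 by exact: sqrt_lt.
have hN : L2_01 (fun t => - (f t - f' t)).
  by apply: L2_01N; apply: L2_01D => //; exact: L2_01N.
have Ef' : E f' <= 2 * E f + 2 * E (fun t => f t - f' t).
  have -> : E f' = E (fun t => f t + - (f t - f' t)).
    by apply: eq_Rintegral => t _; rewrite subKr.
  have <- : E (fun t => - (f t - f' t)) = E (fun t => f t - f' t).
    by apply: eq_Rintegral => t _; rewrite cnorm2N.
  exact: energyD.
have := Ynorm2_Scoef_sub_le _ _ _ _ _ hf hf' iphi iphi' hphi hphi'.
rewrite (finZ _ hphi) (finZ _ hd) -!EFinM -EFinD.
set Y := Ynorm2 _ => hY.
have Y0 : (0 <= Y)%E by apply: esum_ge0 => k _; exact: Ycoef_norm2_ge0.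
have {}hY : fine Y <= E (fun t => f t - f' t) * (2 * fine (Znorm2 phi)) +
    E f' * (2 * fine (Znorm2 (fun t => phi t - phi' t))).
  rewrite -lee_fin fineK// ge0_fin_numE//.
  by apply: le_lt_trans hY _; exact: ltry.
rewrite /Ynorm -/Y -[eps]ger0_norm ?ltW// -sqrtr_sqr ltr_sqrt ?exprn_gt0//.
exact: (modulus_bound _ _ _ _ _ _ _ _ eps0 (z0 phi) (E0 f) (E0 f')
  (z0 (fun t => phi t - phi' t)) Ed Zd Ef' hY).
Qed.
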